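(* In the acoustic setting, suppose $A<0$ and $B>0$ on $[\rho_-,\rho_+]$, $A^2+B^2=1$ at $\rho_\pm$ and $A^2+B^2>1$ on $(\rho_-,\rho_+)$, $A(\rho)=-1$ exactly at $\rho_1<\rho_2$ in $(\rho_-,\rho_+)$, and $A<-1$ on $(\rho_1,\rho_2)$. Then for the $(+)$ family: $d\varphi^+/dt=B(\rho_i)/\rho_i>0$ on the horizons $\rho=\rho_i$ ($i=1,2$), so both are traversed counterclockwise as $t$ increases; $d\rho^+/dt>0$ on $(\rho_-,\rho_1)\cup(\rho_2,\rho_+)$ and $d\rho^+/dt<0$ on $(\rho_1,\rho_2)$ (in particular $(+)$ starts at $\rho=\rho_-$ and ends at $\rho=\rho_+$). Consequently every $(+)$ trajectory with initial radius in $(\rho_-,\rho_1)$ satisfies $\rho^+(t)\to\rho_1$ as $t\to+\infty$; every $(+)$ trajectory with initial radius in $(\rho_1,\rho_2)$ satisfies $\rho^+(t)\to\rho_1$ as $t\to+\infty$ and $\rho^+(t)\to\rho_2$ as $t\to-\infty$; and every $(+)$ trajectory with initial radius in $(\rho_2,\rho_+)$ satisfies $\rho^+(t)\to\rho_2$ as $t\to-\infty$.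
   Context: Acoustic metric in the plane with polar coordinates $(\rho,\varphi)$: Hamiltonian $H=(\tau+A\xi_\rho+B\xi_\varphi/\rho)^2-\xi_\rho^2-(\xi_\varphi/\rho)^2$, $A=A(\rho)$, $B=B(\rho)$ smooth. The ergoregion is the annulus $\rho_-<\rho<\rho_+$ where $A^2+B^2>1$. Zero-energy null geodesics are the null bicharacteristics with $\tau=0$ parametrized by $t$; the sign in $\xi_\rho=\frac{-AB\pm\sqrt{A^2+B^2-1}}{A^2-1}\,\xi_\varphi/\rho$ defines the $(\pm)$ family. With $s=\sqrt{A^2+B^2-1}$, the equations of motion in the ergoregion are $$\frac{d\rho^\pm}{dt}=\frac{A(A^2+B^2-1)\pm Bs}{A^2+B^2},\qquad \frac{d\varphi^\pm}{dt}=\frac{s\,(Bs\mp A)}{\rho\,(A^2+B^2)}.$$ A horizon of the $(\pm)$ family is a circle $\{\rho=c\}$ in the ergoregion which is a closed trajectory of that family. *)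

(* Defs.v *)
From Stdlib Require Import Reals.
Open Scope R_scope.

Fixpoint Cn_on (U : R -> Prop) (n : nat) (f : R -> R) : Prop :=
  match n with
  | O => forall x, U x -> continuity_pt f x
  | S m => exists f' : R -> R,
      (forall x, U x -> derivable_pt_lim f x (f' x)) /\ Cn_on U m f'
  end.

Definition smooth_on (U : R -> Prop) (f : R -> R) : Prop :=
  forall n, Cn_on U n f.

Definition sfun (A B : R -> R) (r : R) : R :=
  sqrt (A r ^ 2 + B r ^ 2 - 1).

(* Equations of motion of zero-energy null geodesics in the ergoregion;
   eps = 1 for the (+) family, eps = -1 for the (-) family. *)
Definition drho (eps : R) (A B : R -> R) (r : R) : R :=
  (A r * (A r ^ 2 + B r ^ 2 - 1) + eps * B r * sfun A B r)
  / (A r ^ 2 + B r ^ 2).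

Definition dphi (eps : R) (A B : R -> R) (r : R) : R :=
  sfun A B r * (B r * sfun A B r - eps * A r)
  / (r * (A r ^ 2 + B r ^ 2)).

Definition traj (eps : R) (A B : R -> R) (rm rp : R) (I : R -> Prop)
  (rho phi : R -> R) : Prop :=
  forall t, I t ->
    rm < rho t < rp /\
    derivable_pt_lim rho t (drho eps A B (rho t)) /\
    derivable_pt_lim phi t (dphi eps A B (rho t)).

Definition lim_pinf (f : R -> R) (l : R) : Prop :=
  forall e, 0 < e -> exists M, forall t, M < t -> Rabs (f t - l) < e.

Definition lim_minf (f : R -> R) (l : R) : Prop :=
  forall e, 0 < e -> exists M, forall t, t < M -> Rabs (f t - l) < e.

(* Main.v *)
Require Import Defs.
From Stdlib Require Import Reals Lra Classical.
Open Scope R_scope.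

(* On the (+) family, [drho] is [s (A s + B) / (A^2 + B^2)], and
   [(A s + B) (B - A s) = (1 - A^2) (A^2 + B^2)] with [B - A s > 0] when
   [A < 0 < B]; so [drho] has the sign of [1 + A]: radii where [A = -1] are
   equilibria of the autonomous equation [rho' = drho rho], attracting from
   the side where [A > -1] below them and [A < -1] above them.  A solution
   starting between equilibria is then trapped (a barrier argument via the
   mean value theorem), monotone, and cannot stop short of the equilibrium it
   moves towards, since [drho] is bounded away from [0] on any compact range
   it would then be confined to. *)

Lemma continuity_pt_near (g : R -> R) (w e : R) :
  continuity_pt g w -> 0 < e ->
  exists del, 0 < del /\ forall x, Rabs (x - w) < del -> Rabs (g x - g w) < e.
Proof.
  intros Hc He. destruct (Hc e He) as [del [Hdel H]].
  exists del; split; [exact Hdel|].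
  intros x Hx. destruct (Req_dec x w) as [->|Hne].
  - rewrite Rminus_diag, Rabs_R0; exact He.
  - apply (H x). repeat split; auto.
Qed.

Lemma ivt_same_side (f : R -> R) (a b v : R) : a < b ->
  (forall x, a <= x <= b -> continuity_pt f x) ->
  (forall x, a <= x <= b -> f x <> v) ->
  v < f a -> v < f b.
Proof.
  intros Hab Hc Hv Ha.
  destruct (Rlt_le_dec v (f b)) as [|Hb]; [assumption|exfalso].
  destruct (Req_dec (f b) v) as [E|]; [apply (Hv b); [lra|exact E]|].
  destruct (Ranalysis5.IVT_interv (fun x => v - f x) a b) as [z [Hz Ez]].
  - intros x Hx. apply continuity_pt_minus; [apply continuity_pt_const; intros ? ?; reflexivity|].
    now apply Hc.
  - exact Hab.
  - lra.
  - lra.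
  - apply (Hv z Hz). lra.
Qed.

Lemma continuity_pt_comp_opp (g : R -> R) (x : R) :
  continuity_pt g (- x) -> continuity_pt (fun y => g (- y)) x.
Proof.
  intro Hg. apply (continuity_pt_comp Ropp g x); [|exact Hg].
  apply continuity_pt_opp, derivable_continuous_pt, derivable_pt_id.
Qed.

Lemma first_crossing (g : R -> R) (a b e : R) : a <= b ->
  (forall x, a <= x <= b -> continuity_pt g x) -> g a < e -> e <= g b ->
  exists w, a < w <= b /\ e <= g w /\ forall x, a <= x < w -> g x < e.
Proof.
  intros Hab Hc Ha Hb.
  set (E := fun x => a <= x <= b /\ forall y, a <= y <= x -> g y < e).
  assert (Hbd : bound E) by (exists b; intros x [Hx _]; lra).
  assert (HEa : E a) by (split; [lra| intros y Hy; replace y with a by lra; exact Ha]).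
  destruct (completeness E Hbd (ex_intro _ a HEa)) as [w [Hub Hlub]].
  assert (Haw : a <= w) by (apply Hub; exact HEa).
  assert (Hwb : w <= b) by (apply Hlub; intros x [Hx _]; lra).
  assert (below : forall x, a <= x < w -> g x < e).
  { intros x Hx.
    destruct (classic (exists z, E z /\ x < z)) as [[z [[_ Hz] Hxz]]|Hn].
    - apply Hz; lra.
    - exfalso. assert (w <= x); [|lra].
      apply Hlub. intros z Ez. destruct (Rle_dec z x) as [|Hzx]; [assumption|].
      exfalso; apply Hn; exists z; split; [exact Ez|lra]. }
  assert (Hew : e <= g w).
  { destruct (Rle_dec e (g w)) as [|Hlt]; [assumption|exfalso].
    (* otherwise [g < e] persists a little beyond [w], contradicting [w = sup E] *)
    destruct (continuity_pt_near g w (e - g w) (Hc w ltac:(lra)) ltac:(lra))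
      as [del [Hdel Hnear]].
    destruct (Req_dec w b) as [->|Hne]; [lra|].
    set (x' := Rmin b (w + del / 2)).
    assert (Hwx' : w < x') by (apply Rmin_glb_lt; lra).
    assert (Hx'b : x' <= b) by apply Rmin_l.
    assert (Hx'd : x' <= w + del / 2) by apply Rmin_r.
    assert (Ex' : E x').
    { split; [lra|]. intros y Hy. destruct (Rlt_dec y w); [apply below; lra|].
      assert (Hyw : Rabs (y - w) < del) by (rewrite Rabs_right; lra).
      specialize (Hnear y Hyw). apply Rabs_def2 in Hnear. lra. }
    specialize (Hub x' Ex'). lra. }
  exists w. split; [|split; [exact Hew|exact below]].
  split; [|exact Hwb]. destruct (Req_dec a w) as [<-|]; lra.
Qed.

Lemma last_crossing (g : R -> R) (a b c : R) : a <= b ->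
  (forall x, a <= x <= b -> continuity_pt g x) -> g a <= c -> c < g b ->
  exists s, a <= s < b /\ g s <= c /\ forall x, s < x <= b -> c < g x.
Proof.
  intros Hab Hc Ha Hb.
  destruct (first_crossing (fun y => - g (- y)) (- b) (- a) (- c))
    as [w [Hw [Hgw Hbefore]]].
  - lra.
  - intros x Hx. apply continuity_pt_opp, continuity_pt_comp_opp, Hc. lra.
  - rewrite Ropp_involutive; lra.
  - rewrite Ropp_involutive; lra.
  - exists (- w). split; [lra|split; [lra|]].
    intros x Hx. specialize (Hbefore (- x) ltac:(lra)).
    rewrite Ropp_involutive in Hbefore. lra.
Qed.

Lemma sublevel_invariant (g D : R -> R) (a b c d : R) : a <= b -> c < d ->
  (forall x, a <= x <= b -> derivable_pt_lim g x (D x)) ->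
  (forall x, a <= x <= b -> c < g x < d -> D x < 0) ->
  g a <= c -> g b <= c.
Proof.
  intros Hab Hcd Hd Hneg Ha.
  destruct (Rle_dec (g b) c) as [|Hb]; [assumption|exfalso].
  assert (Hc : forall x, a <= x <= b -> continuity_pt g x).
  { intros x Hx. apply derivable_continuous_pt. exists (D x). now apply Hd. }
  destruct (last_crossing g a b c Hab Hc Ha ltac:(lra)) as [s [Hs [Hgs Habove]]].
  set (e := Rmin (g b) ((c + d) / 2)).
  assert (Hce : c < e) by (apply Rmin_glb_lt; lra).
  assert (Heb : e <= g b) by apply Rmin_l.
  assert (Hed : e <= (c + d) / 2) by apply Rmin_r.
  destruct (first_crossing g s b e ltac:(lra) ltac:(intros; apply Hc; lra) ltac:(lra) Heb)
    as [w [Hw [Hgw Hbelow]]].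
  (* on [(s, w)] the solution lies in [(c, d)], where it decreases *)
  destruct (MVT_cor2 g D s w ltac:(lra) ltac:(intros; apply Hd; lra)) as [xi [Hmvt Hxi]].
  assert (HDxi : D xi < 0).
  { apply Hneg; [lra|]. split; [apply Habove; lra|].
    specialize (Hbelow xi ltac:(lra)); lra. }
  assert (D xi * (w - s) < 0) by (apply Rmult_neg_pos; lra).
  lra.
Qed.

Lemma superlevel_invariant (g D : R -> R) (a b c d : R) : a <= b -> d < c ->
  (forall x, a <= x <= b -> derivable_pt_lim g x (D x)) ->
  (forall x, a <= x <= b -> d < g x < c -> 0 < D x) ->
  c <= g a -> c <= g b.
Proof.
  intros Hab Hdc Hd Hpos Ha.
  enough (- g b <= - c) by lra.
  apply (sublevel_invariant (fun x => - g x) (fun x => - D x) a b (- c) (- d)); [lra|lra| | |lra].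
  - intros x Hx. apply derivable_pt_lim_opp. now apply Hd.
  - intros x Hx Hg. specialize (Hpos x Hx ltac:(lra)). lra.
Qed.

Definition solution_from (F : R -> R) (t0 : R) (g : R -> R) : Prop :=
  forall t, t0 <= t -> derivable_pt_lim g t (F (g t)).

Lemma lim_pinf_equilibrium_below (F g : R -> R) (t0 lo c d : R) :
  lo < g t0 < c -> c < d ->
  (forall y, lo < y < c -> 0 < F y) ->
  (forall y, c < y < d -> F y < 0) ->
  (forall y, lo < y < c -> continuity_pt F y) ->
  solution_from F t0 g -> lim_pinf g c.
Proof.
  intros Hg0 Hcd Fpos Fneg Fcont Hsol.
  assert (below_c : forall t, t0 <= t -> g t <= c).
  { intros t Ht. apply (sublevel_invariant g (fun x => F (g x)) t0 t c d); try lra.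
    - intros x Hx. apply Hsol; lra.
    - intros x _ Hx. now apply Fneg. }
  assert (nondecreasing : forall T t, t0 <= T -> T <= t -> g T <= g t).
  { intros T t HT Ht.
    assert (HgT : g t0 <= g T).
    { apply (superlevel_invariant g (fun x => F (g x)) t0 T (g t0) lo); try lra.
      - intros x Hx. apply Hsol; lra.
      - intros x _ Hx. apply Fpos; lra. }
    pose proof (below_c T HT).
    apply (superlevel_invariant g (fun x => F (g x)) T t (g T) lo); try lra.
    - intros x Hx. apply Hsol; lra.
    - intros x _ Hx. apply Fpos; lra. }
  intros e He.
  destruct (classic (exists T, t0 <= T /\ c - e < g T)) as [[T [HT HgT]]|Hn].
  - exists T. intros t Ht.
    pose proof (nondecreasing T t HT ltac:(lra)). pose proof (below_c t ltac:(lra)).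
    rewrite Rabs_left1; lra.
  - exfalso.
    assert (stuck : forall T, t0 <= T -> g T <= c - e).
    { intros T HT. apply Rnot_lt_le. intro. apply Hn. now exists T. }
    pose proof (stuck t0 ltac:(lra)).
    (* [F >= m > 0] on [[g t0, c - e]], so [g] would gain more than [c - g t0] *)
    destruct (continuity_ab_min F (g t0) (c - e) ltac:(lra) ltac:(intros; apply Fcont; lra))
      as [ymin [Hmin Hymin]].
    set (m := F ymin).
    assert (Hm : 0 < m) by (apply Fpos; lra).
    set (t := t0 + (c - g t0) / m + 1).
    assert (Htt : t0 < t).
    { assert (0 < (c - g t0) / m) by (apply Rdiv_lt_0_compat; lra). unfold t; lra. }
    destruct (MVT_cor2 g (fun x => F (g x)) t0 t Htt ltac:(intros; apply Hsol; lra))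
      as [xi [Hmvt Hxi]].
    assert (m <= F (g xi)).
    { apply Hmin. split; [apply nondecreasing|apply stuck]; lra. }
    assert (m * (t - t0) <= F (g xi) * (t - t0)) by (apply Rmult_le_compat_r; lra).
    assert (m * (t - t0) = c - g t0 + m) by (unfold t; field; lra).
    pose proof (stuck t ltac:(lra)). lra.
Qed.

Lemma solution_from_opp (F g : R -> R) (t0 : R) :
  solution_from F t0 g -> solution_from (fun y => - F (- y)) t0 (fun t => - g t).
Proof.
  intros Hsol t Ht. rewrite Ropp_involutive.
  apply derivable_pt_lim_opp. now apply Hsol.
Qed.

Lemma solution_from_rev (F g : R -> R) (t1 : R) :
  (forall t, t <= t1 -> derivable_pt_lim g t (F (g t))) ->
  solution_from (fun y => - F y) (- t1) (fun s => g (- s)).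
Proof.
  intros Hsol s Hs. replace (- F (g (- s))) with (F (g (- s)) * -1) by ring.
  apply (derivable_pt_lim_comp Ropp g s (-1)).
  - apply (derivable_pt_lim_opp id), derivable_pt_lim_id.
  - apply Hsol; lra.
Qed.

Lemma lim_pinf_equilibrium_above (F g : R -> R) (t0 lo c hi : R) :
  c < g t0 < hi -> lo < c ->
  (forall y, c < y < hi -> F y < 0) ->
  (forall y, lo < y < c -> 0 < F y) ->
  (forall y, c < y < hi -> continuity_pt F y) ->
  solution_from F t0 g -> lim_pinf g c.
Proof.
  intros Hg0 Hlc Fneg Fpos Fcont Hsol e He.
  destruct (lim_pinf_equilibrium_below (fun y => - F (- y)) (fun t => - g t)
              t0 (- hi) (- c) (- lo)) with (e := e) as [M HM]; try lra.
  - intros y Hy. specialize (Fneg (- y) ltac:(lra)). lra.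
  - intros y Hy. specialize (Fpos (- y) ltac:(lra)). lra.
  - intros y Hy. apply continuity_pt_opp, continuity_pt_comp_opp, Fcont. lra.
  - now apply solution_from_opp.
  - exists M. intros t Ht. specialize (HM t Ht).
    replace (g t - c) with (- (- g t - - c)) by ring. now rewrite Rabs_Ropp.
Qed.

Lemma lim_minf_of_rev (g : R -> R) (l : R) :
  lim_pinf (fun s => g (- s)) l -> lim_minf g l.
Proof.
  intros H e He. destruct (H e He) as [M HM].
  exists (- M). intros t Ht. specialize (HM (- t) ltac:(lra)).
  now rewrite Ropp_involutive in HM.
Qed.

Lemma continuity_pt_of_smooth_on (U : R -> Prop) (f : R -> R) (x : R) :
  smooth_on U f -> U x -> continuity_pt f x.
Proof. intros Hf Hx. exact (Hf O x Hx). Qed.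

Lemma continuity_pt_drho (A B : R -> R) (eps x : R) :
  continuity_pt A x -> continuity_pt B x -> 1 < A x ^ 2 + B x ^ 2 ->
  continuity_pt (drho eps A B) x.
Proof.
  intros cA cB Hq.
  set (Q := ((A * A + B * B) - fct_cte 1)%F).
  assert (cQ : continuity_pt Q x).
  { apply continuity_pt_minus; [|apply continuity_pt_const; intros ? ?; reflexivity].
    apply continuity_pt_plus; apply continuity_pt_mult; assumption. }
  apply (continuity_pt_locally_ext
           ((A * Q + (fct_cte eps * B) * comp sqrt Q) / (A * A + B * B))%F _ 1);
    [lra| |].
  { intros y _. unfold drho, sfun, Q, comp, div_fct, plus_fct, mult_fct, minus_fct, fct_cte.
    f_equal; [f_equal|]; try ring. f_equal. f_equal. ring. }
  apply continuity_pt_div.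
  - apply continuity_pt_plus; apply continuity_pt_mult; try assumption.
    + apply continuity_pt_mult; [apply continuity_pt_const; intros ? ?; reflexivity|assumption].
    + apply continuity_pt_comp; [assumption|]. apply continuity_pt_sqrt.
      unfold Q, minus_fct, plus_fct, mult_fct, fct_cte. nra.
  - apply continuity_pt_plus; apply continuity_pt_mult; assumption.
  - unfold plus_fct, mult_fct. nra.
Qed.

Lemma drho_plus_factor (A B : R -> R) (r : R) : 1 <= A r ^ 2 + B r ^ 2 ->
  drho 1 A B r = sfun A B r * (A r * sfun A B r + B r) / (A r ^ 2 + B r ^ 2).
Proof.
  intros Hq. unfold drho.
  assert (Hs : sfun A B r * sfun A B r = A r ^ 2 + B r ^ 2 - 1)
    by (apply sqrt_sqrt; lra).
  f_equal. rewrite <- Hs. ring.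
Qed.

Lemma plus_factor_identity (a b s : R) : a < 0 -> 0 < b ->
  s * s = a ^ 2 + b ^ 2 - 1 -> 0 <= s ->
  (a * s + b) * (b - a * s) = (1 - a ^ 2) * (a ^ 2 + b ^ 2) /\ 0 < b - a * s.
Proof.
  intros Ha Hb Hs Hs0. split; [|nra].
  transitivity (b ^ 2 - a ^ 2 * (s * s)); [ring|rewrite Hs; ring].
Qed.

Lemma drho_plus_sign (A B : R -> R) (r : R) :
  1 < A r ^ 2 + B r ^ 2 -> A r < 0 -> 0 < B r ->
  (-1 < A r -> 0 < drho 1 A B r) /\ (A r < -1 -> drho 1 A B r < 0).
Proof.
  intros Hq HA HB. rewrite drho_plus_factor by lra.
  assert (Hs : 0 < sfun A B r) by (apply sqrt_lt_R0; lra).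
  assert (Hss : sfun A B r * sfun A B r = A r ^ 2 + B r ^ 2 - 1)
    by (apply sqrt_sqrt; lra).
  destruct (plus_factor_identity (A r) (B r) (sfun A B r) HA HB Hss ltac:(lra))
    as [Hprod Hconj].
  set (k := A r * sfun A B r + B r) in *.
  split; intro HAr.
  - apply Rdiv_lt_0_compat; [|lra]. apply Rmult_lt_0_compat; [exact Hs|].
    assert (0 < (1 - A r ^ 2) * (A r ^ 2 + B r ^ 2)) by (apply Rmult_lt_0_compat; nra).
    nra.
  - apply Rdiv_neg_pos; [|lra]. apply Rmult_pos_neg; [exact Hs|].
    assert ((1 - A r ^ 2) * (A r ^ 2 + B r ^ 2) < 0) by (apply Rmult_neg_pos; nra).
    nra.
Qed.

Lemma sfun_at_A_m1 (A B : R -> R) (r : R) : A r = -1 -> 0 <= B r -> sfun A B r = B r.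
Proof.
  intros HA HB. unfold sfun. rewrite HA.
  replace ((-1) ^ 2 + B r ^ 2 - 1) with (Rsqr (B r)) by (unfold Rsqr; ring).
  now apply sqrt_Rsqr.
Qed.

Lemma drho_plus_at_A_m1 (A B : R -> R) (r : R) :
  A r = -1 -> 0 <= B r -> drho 1 A B r = 0.
Proof.
  intros HA HB. unfold drho. rewrite sfun_at_A_m1, HA by assumption.
  unfold Rdiv. ring.
Qed.

Lemma dphi_plus_at_A_m1 (A B : R -> R) (r : R) :
  A r = -1 -> 0 < B r -> r <> 0 -> dphi 1 A B r = B r / r.
Proof.
  intros HA HB Hr. unfold dphi. rewrite sfun_at_A_m1, HA by lra.
  field. split; [exact Hr|nra].
Qed.

Lemma horizon_traj_plus (A B : R -> R) (rm rp ri phi0 : R) :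
  rm < ri < rp -> ri <> 0 -> A ri = -1 -> 0 < B ri ->
  traj 1 A B rm rp (fun _ => True) (fun _ => ri) (fun t => phi0 + B ri / ri * t).
Proof.
  intros Hri Hri0 HA HB t _. split; [exact Hri|split].
  - rewrite drho_plus_at_A_m1 by lra. apply derivable_pt_lim_const.
  - rewrite dphi_plus_at_A_m1 by assumption.
    change (derivable_pt_lim (fct_cte phi0 + mult_real_fct (B ri / ri) id)%F t (B ri / ri)).
    replace (B ri / ri) with (0 + B ri / ri * 1) at 2 by ring.
    apply derivable_pt_lim_plus.
    + apply derivable_pt_lim_const.
    + apply derivable_pt_lim_scal, derivable_pt_lim_id.
Qed.

Section PlusFamily.

Variables (A B : R -> R) (rm rp r1 r2 : R).
Hypothesis contA : forall r, rm <= r <= rp -> continuity_pt A r.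
Hypothesis contB : forall r, rm <= r <= rp -> continuity_pt B r.
Hypotheses (hrm : 0 < rm) (hr1 : rm < r1) (hr12 : r1 < r2) (hr2 : r2 < rp).
Hypothesis hneg : forall r, rm <= r <= rp -> A r < 0.
Hypothesis hpos : forall r, rm <= r <= rp -> 0 < B r.
Hypothesis hbm : A rm ^ 2 + B rm ^ 2 = 1.
Hypothesis hbp : A rp ^ 2 + B rp ^ 2 = 1.
Hypothesis herg : forall r, rm < r < rp -> 1 < A r ^ 2 + B r ^ 2.
Hypothesis hAm1 : forall r, rm < r < rp -> (A r = -1 <-> r = r1 \/ r = r2).
Hypothesis hAlt : forall r, r1 < r < r2 -> A r < -1.

Lemma A_ne_m1_off_horizons (r : R) : rm <= r <= rp -> r <> r1 -> r <> r2 -> A r <> -1.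
Proof.
  intros Hr H1 H2 HAr.
  destruct (Req_dec r rm) as [->|]; [pose proof (hpos rm ltac:(lra)); nra|].
  destruct (Req_dec r rp) as [->|]; [pose proof (hpos rp ltac:(lra)); nra|].
  apply hAm1 in HAr; lra.
Qed.

Lemma A_gt_m1_outside (r : R) : rm < r < r1 \/ r2 < r < rp -> -1 < A r.
Proof.
  assert (cA1 : forall x, rm <= x <= rp -> continuity_pt (fun y => A y + 1) x).
  { intros x Hx. apply (continuity_pt_plus A (fct_cte 1)); [now apply contA|].
    apply continuity_pt_const; intros ? ?; reflexivity. }
  intros [Hr|Hr].
  - enough (0 < A r + 1) by lra.
    apply (ivt_same_side (fun y => A y + 1) rm r 0); try lra.
    + intros x Hx. apply cA1; lra.
    + intros x Hx. assert (Hx' : rm <= x <= rp) by lra.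
      apply A_ne_m1_off_horizons in Hx'; lra.
    + pose proof (hneg rm ltac:(lra)); pose proof (hpos rm ltac:(lra)); nra.
  - enough (0 < A (- - r) + 1) by (rewrite Ropp_involutive in *; lra).
    apply (ivt_same_side (fun y => A (- y) + 1) (- rp) (- r) 0); try lra.
    + intros x Hx. apply (continuity_pt_comp_opp (fun y => A y + 1)), cA1. lra.
    + intros x Hx. assert (Hx' : rm <= - x <= rp) by lra.
      apply A_ne_m1_off_horizons in Hx'; lra.
    + rewrite Ropp_involutive.
      pose proof (hneg rp ltac:(lra)); pose proof (hpos rp ltac:(lra)); nra.
Qed.

Lemma drho_plus_pos_outside (r : R) : rm < r < r1 \/ r2 < r < rp -> 0 < drho 1 A B r.
Proof.
  intros Hr. apply drho_plus_sign; [apply herg|apply hneg|apply hpos|]; try lra.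
  now apply A_gt_m1_outside.
Qed.

Lemma drho_plus_neg_between (r : R) : r1 < r < r2 -> drho 1 A B r < 0.
Proof.
  intros Hr. apply drho_plus_sign; [apply herg|apply hneg|apply hpos|apply hAlt]; lra.
Qed.

Lemma continuity_pt_drho_plus (r : R) : rm < r < rp -> continuity_pt (drho 1 A B) r.
Proof.
  intros Hr. apply continuity_pt_drho; [apply contA|apply contB|apply herg]; lra.
Qed.

Lemma continuity_pt_opp_drho_plus (r : R) :
  rm < r < rp -> continuity_pt (fun y => - drho 1 A B y) r.
Proof. intros Hr. now apply continuity_pt_opp, continuity_pt_drho_plus. Qed.

Lemma horizons_plus (ri : R) : ri = r1 \/ ri = r2 ->
  dphi 1 A B ri = B ri / ri /\ 0 < B ri / ri /\
  forall phi0, traj 1 A B rm rp (fun _ => True)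
                 (fun _ => ri) (fun t => phi0 + (B ri / ri) * t).
Proof.
  intros Hri.
  assert (HAri : A ri = -1) by (apply hAm1; lra).
  assert (HBri : 0 < B ri) by (apply hpos; lra).
  split; [apply dphi_plus_at_A_m1; lra|split; [apply Rdiv_lt_0_compat; lra|]].
  intros phi0. apply horizon_traj_plus; lra.
Qed.

Lemma lim_pinf_plus_below_r1 (a : R) (rho phi : R -> R) :
  traj 1 A B rm rp (fun t => a < t) rho phi ->
  forall t0, a < t0 -> rm < rho t0 < r1 -> lim_pinf rho r1.
Proof.
  intros Htraj t0 Ha Ht0.
  apply (lim_pinf_equilibrium_below (drho 1 A B) rho t0 rm r1 r2); try lra.
  - intros y Hy; apply drho_plus_pos_outside; lra.
  - exact drho_plus_neg_between.
  - intros y Hy; apply continuity_pt_drho_plus; lra.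
  - intros t Ht. apply Htraj; lra.
Qed.

Lemma lim_plus_between (rho phi : R -> R) :
  traj 1 A B rm rp (fun _ => True) rho phi ->
  forall t0, r1 < rho t0 < r2 -> lim_pinf rho r1 /\ lim_minf rho r2.
Proof.
  intros Htraj t0 Ht0. split.
  - apply (lim_pinf_equilibrium_above (drho 1 A B) rho t0 rm r1 r2); try lra.
    + exact drho_plus_neg_between.
    + intros y Hy; apply drho_plus_pos_outside; lra.
    + intros y Hy; apply continuity_pt_drho_plus; lra.
    + intros t _. now apply Htraj.
  - apply lim_minf_of_rev.
    apply (lim_pinf_equilibrium_below (fun y => - drho 1 A B y) _ (- t0) r1 r2 rp).
    + rewrite Ropp_involutive; lra.
    + lra.
    + intros y Hy. pose proof (drho_plus_neg_between y Hy). lra.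
    + intros y Hy. pose proof (drho_plus_pos_outside y ltac:(lra)). lra.
    + intros y Hy. apply continuity_pt_opp_drho_plus; lra.
    + apply (solution_from_rev (drho 1 A B) rho t0). intros t _. now apply Htraj.
Qed.

Lemma lim_minf_plus_above_r2 (b : R) (rho phi : R -> R) :
  traj 1 A B rm rp (fun t => t < b) rho phi ->
  forall t0, t0 < b -> r2 < rho t0 < rp -> lim_minf rho r2.
Proof.
  intros Htraj t0 Hb Ht0. apply lim_minf_of_rev.
  apply (lim_pinf_equilibrium_above (fun y => - drho 1 A B y) _ (- t0) r1 r2 rp).
  - rewrite Ropp_involutive; lra.
  - lra.
  - intros y Hy. pose proof (drho_plus_pos_outside y ltac:(lra)). lra.
  - intros y Hy. pose proof (drho_plus_neg_between y Hy). lra.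
  - intros y Hy. apply continuity_pt_opp_drho_plus; lra.
  - apply (solution_from_rev (drho 1 A B) rho t0). intros t Ht. apply Htraj; lra.
Qed.

End PlusFamily.

Theorem mainTheorem8 (A B : R -> R) (rm rp r1 r2 : R)
  (hA : smooth_on (fun r => 0 < r) A)
  (hB : smooth_on (fun r => 0 < r) B)
  (hrm : 0 < rm) (hr1 : rm < r1) (hr12 : r1 < r2) (hr2 : r2 < rp)
  (hneg : forall r, rm <= r <= rp -> A r < 0)
  (hpos : forall r, rm <= r <= rp -> 0 < B r)
  (hbm : A rm ^ 2 + B rm ^ 2 = 1)
  (hbp : A rp ^ 2 + B rp ^ 2 = 1)
  (herg : forall r, rm < r < rp -> 1 < A r ^ 2 + B r ^ 2)
  (hAm1 : forall r, rm < r < rp -> (A r = -1 <-> r = r1 \/ r = r2))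
  (hAlt : forall r, r1 < r < r2 -> A r < -1) :
  (forall ri, (ri = r1 \/ ri = r2) ->
     dphi 1 A B ri = B ri / ri /\ 0 < B ri / ri /\
     forall phi0, traj 1 A B rm rp (fun _ => True)
                    (fun _ => ri) (fun t => phi0 + (B ri / ri) * t)) /\
  (forall r, (rm < r < r1 \/ r2 < r < rp) -> 0 < drho 1 A B r) /\
  (forall r, r1 < r < r2 -> drho 1 A B r < 0) /\
  (forall a rho phi, traj 1 A B rm rp (fun t => a < t) rho phi ->
     forall t0, a < t0 -> rm < rho t0 < r1 -> lim_pinf rho r1) /\
  (forall rho phi, traj 1 A B rm rp (fun _ => True) rho phi ->
     forall t0, r1 < rho t0 < r2 -> lim_pinf rho r1 /\ lim_minf rho r2) /\
  (forall b rho phi, traj 1 A B rm rp (fun t => t < b) rho phi ->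
     forall t0, t0 < b -> r2 < rho t0 < rp -> lim_minf rho r2).
Proof.
  assert (contA : forall r, rm <= r <= rp -> continuity_pt A r)
    by (intros r Hr; apply (continuity_pt_of_smooth_on _ _ _ hA); lra).
  assert (contB : forall r, rm <= r <= rp -> continuity_pt B r)
    by (intros r Hr; apply (continuity_pt_of_smooth_on _ _ _ hB); lra).
  split; [|split; [|split; [|split; [|split]]]].
  - eapply horizons_plus; eauto.
  - eapply drho_plus_pos_outside; eauto.
  - eapply drho_plus_neg_between; eauto.
  - eapply lim_pinf_plus_below_r1; eauto.
  - eapply lim_plus_between; eauto.
  - eapply lim_minf_plus_above_r2; eauto.
Qed.
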